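(* Let $W:A^{\mathbb{Z}}\times\mathcal{B}^{\mathbb{Z}}\to\mathbb{C}$ be a stationary IMC cq-channel and $\varepsilon>0$. Then every code $\mathcal{C}_n=(u_i,b_i)_{i=1}^{M_n}$ of blocklength $n$ with $M_n\ge2^{n(C_{\mathrm{Holevo}}(W)+\varepsilon)}$ satisfies $$\bar e(\mathcal{C}_n)\ge1-\frac{C_{\mathrm{Holevo}}(W)+\frac1n}{C_{\mathrm{Holevo}}(W)+\varepsilon}.$$
   Context: $A$ finite, $\mathcal{B}=\mathcal{L}(\mathcal{H})$ with $\mathcal{H}$ finite-dimensional, $\mathcal{B}^{\mathbb{Z}}$ the quasi-local algebra, $\mathcal{B}^n=\mathcal{B}^{[1,n]}$. A cq-channel $W$: $x\mapsto W(x,b)$ Borel measurable, $b\mapsto W(x,b)$ a state. Stationary: $W(T_{in}x,b)=W(x,T_{out}b)$. IMC: causal ($W(x,b)=W(\tilde x,b)$ for $b$ in the algebra of sites $\le n$ whenever $x_i=\tilde x_i$, $i\le n$) and input memoryless (same for sites $\ge n$ and $x_i=\tilde x_i$, $i\ge n$); then $W^n(x^n,\cdot)$ is a state on $\mathcal{B}^n$ with density $D_{x^n}$. A code $(u_i,b_i)_{i=1}^M$: $u_i\in A^n$, $0\le b_i\in\mathcal{B}^n$, $\sum b_i\le\mathbf{1}$. Average error $\bar e(\mathcal{C})=\frac1M\sum_{i=1}^M\sup_{x\in[u_i]}(1-W(x,b_i))$ ($[u_i]$ the cylinder set). $\chi(p^n,W^n)=S(\sum p^n(x^n)D_{x^n})-\sum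 p^n(x^n)S(D_{x^n})$, $S(D)=-\mathrm{tr}D\log D$, $C_n(W)=\max_{p^n}\chi(p^n,W^n)$, $C_{\mathrm{Holevo}}(W)=\lim_n\frac1nC_n(W)=\sup_n\frac1nC_n(W)$. Logs base 2. *)

(* Defs.v *)
From HB Require Import structures.
From mathcomp Require Import all_boot all_order all_algebra.
From mathcomp Require Import complex mxtens.
From mathcomp Require Import classical_sets reals exp measure.

Set Implicit Arguments.
Unset Strict Implicit.
Unset Printing Implicit Defensive.

Import Order.TTheory GRing.Theory Num.Theory.
Local Open Scope ring_scope.
Local Open Scope classical_set_scope.

Section CQ.

Variable R : realType.
Notation C := (R[i]).

(* Matrices on d-dimensional sites.  The local algebra of k consecutive *)
(* sites [a, a+k-1] of B^Z (B = L(H), dim H = d) is 'M[C]_(d ^ k);     *)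
(* tensor factors are ordered from left (site a) to right (site a+k-1). *)

Definition adjmx m n (M : 'M[C]_(m, n)) : 'M[C]_(n, m) := (map_mx Num.conj M)^T.

Definition psd n (M : 'M[C]_n) : Prop :=
  M \is hermsymmx /\ forall v : 'rV[C]_n, 0 <= (v *m M *m adjmx v) 0 0.

Definition density n (D : 'M[C]_n) : Prop := psd D /\ \tr D = 1.

Definition ext_right d k (X : 'M[C]_(d ^ k)) : 'M[C]_(d ^ k.+1) :=
  castmx (esym (expnSr d k), esym (expnSr d k)) (X *t (1%:M : 'M[C]_d)).

Definition ext_left d k (X : 'M[C]_(d ^ k)) : 'M[C]_(d ^ k.+1) :=
  castmx (esym (expnS d k), esym (expnS d k)) ((1%:M : 'M[C]_d) *t X).

(* A state on the quasi-local algebra B^Z, given by its (consistent)    *)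
(* family of local density matrices: rho a k is the density matrix of   *)
(* the restriction of the state to the local algebra of [a, a+k-1].    *)
Definition qstate d (rho : int -> forall k, 'M[C]_(d ^ k)) : Prop :=
  (forall a k, density (rho a k)) /\
  (forall a k (X : 'M[C]_(d ^ k)),
      \tr (rho a k.+1 *m ext_right X) = \tr (rho a k *m X)) /\
  (forall a k (X : 'M[C]_(d ^ k)),
      \tr (rho a k.+1 *m ext_left X) = \tr (rho (a + 1)%R k *m X)).

(* A (candidate) cq-channel: to each input sequence x in A^Z, the local *)
(* densities of the output state W(x, .).                               *)
Definition channel (A : finType) (d : nat) :=
  (int -> A) -> int -> forall k, 'M[C]_(d ^ k).

Definition Wloc (A : finType) d (W : channel A d) (x : int -> A) (a : int) k
  (b : 'M[C]_(d ^ k)) : C := \tr (W x a k *m b).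
Arguments Wloc {A d} W x a k b.

Definition elem_cylinders (A : finType) : set (set (int -> A)) :=
  [set E | exists (i : int) (c : A), E = [set x | x i = c]].

Definition borel_AZ (A : finType) : set (set (int -> A)) :=
  <<s (@elem_cylinders A) >>.

Definition meas_AZ (A : finType) (f : (int -> A) -> R) : Prop :=
  forall r : R, @borel_AZ A [set x | f x <= r].

Definition cq_channel (A : finType) d (W : channel A d) : Prop :=
  (forall x, qstate (W x)) /\
  (forall a k (b : 'M[C]_(d ^ k)),
      meas_AZ (fun x => complex.Re (Wloc W x a k b)) /\
      meas_AZ (fun x => complex.Im (Wloc W x a k b))).

(* shift on A^Z;  T_out is the corresponding shift on B^Z, moving an   *)
(* observable located on [a, a+k-1] to [a+1, a+k].                      *)
Definition Tin (A : finType) (x : int -> A) : int -> A := fun i => x (i + 1)%R.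

Definition stationary (A : finType) d (W : channel A d) : Prop :=
  forall x a k (b : 'M[C]_(d ^ k)),
    Wloc W (Tin x) a k b = Wloc W x (a + 1)%R k b.

Definition causal (A : finType) d (W : channel A d) : Prop :=
  forall (n : int) (x x' : int -> A), (forall i, (i <= n)%R -> x i = x' i) ->
  forall (a : int) k (b : 'M[C]_(d ^ k)), (a + k%:Z - 1 <= n)%R ->
    Wloc W x a k b = Wloc W x' a k b.

Definition input_memoryless (A : finType) d (W : channel A d) : Prop :=
  forall (n : int) (x x' : int -> A), (forall i, (n <= i)%R -> x i = x' i) ->
  forall (a : int) k (b : 'M[C]_(d ^ k)), (n <= a)%R ->
    Wloc W x a k b = Wloc W x' a k b.

Definition IMC (A : finType) d (W : channel A d) : Prop :=
  causal W /\ input_memoryless W.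

Definition cyl (A : finType) n (u : n.-tuple A) : set (int -> A) :=
  [set x | forall j : 'I_n, x (Posz j.+1) = tnth u j].

Definition ext_word (A : finType) (a0 : A) (u : seq A) : int -> A :=
  fun i => match i with Posz m.+1 => nth a0 u m | _ => a0 end.

Definition Dn (A : finType) d (W : channel A d) n (u : n.-tuple A)
  : 'M[C]_(d ^ n) :=
  match [pick a : A] with
  | Some a0 => W (ext_word a0 u) 1 n
  | None => 0
  end.

Definition log2 (t : R) : R := ln t / ln 2.
Definition eta (t : R) : R := if t == 0 then 0 else t * log2 t.

Definition vN_entropy n (D : 'M[C]_n) : R :=
  - \sum_(j < n) eta (complex.Re (spectral_diag D 0 j)).

Definition distribution (T : finType) (p : T -> R) : Prop :=
  (forall t, 0 <= p t) /\ \sum_t p t = 1.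

Definition toC (r : R) : C := (r +i* 0)%C.

Definition holevo_chi (A : finType) d (W : channel A d) n
  (p : n.-tuple A -> R) : R :=
  vN_entropy (\sum_(u : n.-tuple A) toC (p u) *: Dn W u)
  - \sum_(u : n.-tuple A) p u * vN_entropy (Dn W u).

Definition Cn (A : finType) d (W : channel A d) n : R :=
  sup [set holevo_chi W p | p in [set p : n.-tuple A -> R | distribution p]].

(* C_Holevo(W) = sup_n (1/n) C_n(W) (= lim_n (1/n) C_n(W)) *)
Definition C_Holevo (A : finType) d (W : channel A d) : R :=
  sup [set Cn W n / n%:R | n in [set n : nat | (0 < n)%N]].

Definition is_code d n M (b : 'I_M -> 'M[C]_(d ^ n)) : Prop :=
  (forall i, psd (b i)) /\ psd (1%:M - \sum_i b i).

Definition avg_error (A : finType) d (W : channel A d) n M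
  (u : 'I_M -> n.-tuple A) (b : 'I_M -> 'M[C]_(d ^ n)) : R :=
  M%:R^-1 * \sum_(i < M)
     sup [set 1 - complex.Re (Wloc W x 1 n (b i)) | x in cyl (u i)].

End CQ.

(* Main.v *)
Require Import Defs.
From HB Require Import structures.
From mathcomp Require Import all_boot all_order all_algebra.
From mathcomp Require Import complex mxtens.
From mathcomp Require Import classical_sets reals exp measure.
From mathcomp Require Import boolp topology normedtype derive realfun.
From mathcomp Require Import ring lra.

(* The Holevo quantity of the uniform distribution on the codebook bounds the
   information carried by the binary event "the decoder hits the transmitted
   index".  Let w i = 1/M, D i be the output densities, E their average,
   r i and s the spectra of D i and E, and T i the matrix of overlaps of the
   eigenbases.  Then ln 2 times the Holevo quantity is the classical relative
   entropy of p(i,j,k) = w i r_j |T_jk|^2 with respect to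
   w i s_k |T_jk|^2 (Nussbaum-Szkola).  Since ln is an integral of
   resolvents, data processing reduces to comparing the sums of
   p^2 / (p' + l p) for every l > 0; each of them is a supremum of quadratic
   polynomials, in which one tests with X i = x1 b i + x0 (1 - b i), for which
   X i ^ 2 <= x1^2 b i + x0^2 (1 - b i).  The average of tr (E b i) is at most
   1/M because the b i sum to at most 1, so Fano's estimate gives
   P log M - 1 <= chi <= n C_Holevo for the average success probability P. *)

Import Order.TTheory GRing.Theory Num.Theory.
Import numFieldNormedType.Exports.
Local Open Scope ring_scope.

Set Implicit Arguments.
Unset Strict Implicit.
Unset Printing Implicit Defensive.

(** * Logarithmic sums compared through resolvents *)

(* The difference of the two sides, with [a] and [c] shifted by [l], increases
   with [l] and vanishes at infinity. *)
Lemma stieltjes_le_ln (R : realType) (T S : finType)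
    (P a : T -> R) (p c : S -> R) :
    (forall z, 0 <= P z) -> (forall z, 0 < a z) ->
    (forall s, 0 <= p s) -> (forall s, 0 < c s) ->
    \sum_z P z = \sum_s p s ->
    (forall l : R, 0 < l -> \sum_s p s / (c s + l) <= \sum_z P z / (a z + l)) ->
  \sum_z P z * ln (a z) <= \sum_s p s * ln (c s).
Proof.
move=> P0 a0 p0 c0 eqPp hl.
pose G (U : finType) (w e : U -> R) (l : R) := \sum_z w z * ln (e z + l).
have dG (U : finType) (w e : U -> R) (l : R) : (forall z, 0 < e z) -> 0 <= l ->
    is_derive l 1 (G U w e) (\sum_z w z / (e z + l)).
  move=> e0 l0.
  rewrite /G; elim: (index_enum U) => [|z r IH].
    rewrite big_nil; under eq_fun do rewrite big_nil; exact: is_derive_cst.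
  rewrite big_cons; under eq_fun do rewrite big_cons.
  apply: (@is_deriveD _ _ _ (fun l => w z * ln (e z + l))) => //.
  have el : 0 < e z + l by rewrite ltr_pwDl.
  have h1 : is_derive l (1:R) (fun l => e z + l) 1.
    have := @is_deriveD _ _ _ (fun=> e z) id l (1:R) _ _
      (is_derive_cst (e z) l 1) (is_derive_id l 1).
    by rewrite add0r.
  have h2 : is_derive l (1:R) (fun l => ln (e z + l)) (e z + l)^-1.
    have := is_derive1_ln el => h3.
    by apply: (@is_derive_eq _ _ _ _ _ _ _ _ (is_derive1_comp h3 h1)); rewrite mulr1.
  exact: (is_deriveZ (w z)).
pose H l := G T P a l - G S p c l.
have dH (l : R) : 0 <= l -> is_derive l 1 H
    (\sum_z P z / (a z + l) - \sum_s p s / (c s + l)).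
  by move=> l0; apply: is_deriveB; apply: dG.
have Hmono (l : R) : 0 < l -> H 0 <= H l.
  move=> l0; apply: (@ger0_derive1_le_cc _ H 0 l).
  - by move=> x; rewrite in_itv/= => /andP[/ltW/dH[]].
  - move=> x; rewrite in_itv/= => /andP[x0 _].
    by have [_ ] := dH _ (ltW x0); rewrite derive1E => ->; rewrite subr_ge0 hl.
  - apply: derivable_within_continuous => x; rewrite in_itv/= => /andP[x0 _].
    by have [] := dH _ x0.
  - by rewrite in_itv/= lexx ltW.
  - by rewrite in_itv/= lexx ltW.
  - exact: ltW.
(* Write [ln (a z + l) = ln l + ln (1 + a z / l)], where the last term is at most [a z / l], and
   bound [ln (c s + l)] below by [ln l]; the [ln l] contributions cancel because the total masses
   agree. *)
have Hup (l : R) : 0 < l -> H l <= (\sum_z P z * a z) / l.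
  move=> l0.
  rewrite /H /G lerBlDr.
  apply: (@le_trans _ _ (\sum_z P z * (a z / l) + \sum_z P z * ln l)).
    rewrite -big_split/=; apply: ler_sum => z _.
    rewrite -mulrDr; apply: ler_wpM2l => //.
    have -> : a z + l = l * (1 + a z / l) by field; rewrite gt_eqF.
    have az : 0 < a z / l by rewrite divr_gt0.
    rewrite lnM ?posrE //; last by rewrite addr_gt0.
    by rewrite addrC lerD2r le_ln1Dx // (lt_trans (ltrN10 R) az).
  rewrite mulr_suml; under eq_bigr do rewrite mulrA.
  rewrite lerD2l -!mulr_suml eqPp mulr_suml; apply: ler_sum => s _.
  by apply: ler_wpM2l => //; rewrite ler_ln ?posrE ?addr_gt0 // lerDr ltW.
have K0 : 0 <= \sum_z P z * a z by apply: sumr_ge0 => z _; rewrite mulr_ge0 // ltW.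
have : H 0 <= 0.
  rewrite leNgt; apply/negP => H0.
  set K := (\sum_z P z * a z) in K0 Hup.
  (* At this [l] the upper bound [K / l] equals [H 0 * K / (K + 1)], which is smaller than [H 0]. *)
  have l0 : 0 < (K + 1) / H 0 by rewrite divr_gt0 // ltr_wpDl.
  have := le_trans (Hmono _ l0) (Hup _ l0).
  rewrite invf_div mulrA ler_pdivlMr ?ltr_wpDl // mulrC ler_pM2r //.
  by rewrite gerDl ler10.
rewrite /H /G subr_le0.
by under eq_bigr do rewrite addr0; under [X in _ <= X -> _]eq_bigr do rewrite addr0.
Qed.

(** * Complex scalars and their real parts *)

Section Complex.
Variable R : realType.
Local Notation C := R[i].
Local Notation Re := complex.Re.

Definition sqnorm (z : C) : R := Re z ^+ 2 + complex.Im z ^+ 2.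

Lemma sqnorm_ge0 z : 0 <= sqnorm z.
Proof. by rewrite addr_ge0 ?sqr_ge0. Qed.

Lemma mul_conj_sqnorm (z : C) : z * Num.conj z = toC (sqnorm z).
Proof. by case: z => a b; rewrite /toC /sqnorm; simpc; congr Complex; ring. Qed.

Lemma ReD (z w : C) : Re (z + w) = Re z + Re w.
Proof. by case: z w => ? ? []. Qed.

Lemma ReN (z : C) : Re (- z) = - Re z.
Proof. by case: z. Qed.

Lemma Re_sum (I : finType) (F : I -> C) : Re (\sum_i F i) = \sum_i Re (F i).
Proof. by elim/big_rec2: _ => [|i y1 y2 _ <-]; rewrite ?ReD. Qed.

Lemma Re_toCM (r : R) (z : C) : Re (toC r * z) = r * Re z.
Proof. by case: z => a b; rewrite /toC; simpc. Qed.

Lemma toCM (r s : R) : toC (r * s) = toC r * toC s.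
Proof. exact: (rmorphM (real_complex R)). Qed.

Lemma toCD (r s : R) : toC (r + s) = toC r + toC s.
Proof. exact: (rmorphD (real_complex R)). Qed.

Lemma toC_sum (I : finType) (P : pred I) (F : I -> R) :
  toC (\sum_(i | P i) F i) = \sum_(i | P i) toC (F i).
Proof. exact: (rmorph_sum (real_complex R)). Qed.

Lemma conj_toC (r : R) : Num.conj (toC r) = toC r.
Proof. exact: conjc_real. Qed.

Lemma toC_ge0 (r : R) : (0 <= toC r) = (0 <= r).
Proof. exact: ler0c. Qed.

Lemma Re_ge0 (z : C) : 0 <= z -> 0 <= Re z.
Proof. by rewrite lecE => /andP[]. Qed.

Lemma toC_Re_ge0 (z : C) : 0 <= z -> toC (Re z) = z.
Proof. by move=> /ger0_Im; case: z => a b /= ->. Qed.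

(** The right side minus the left side is the squared modulus of [r t - c y] divided by [c]. *)
Lemma completed_square (y t : C) (r c : R) : 0 < c ->
  2 * r * Re (y * Num.conj t) - sqnorm y * c <= r ^+ 2 / c * sqnorm t.
Proof.
move=> c0; case: y t => [y1 y2] [t1 t2]; rewrite /sqnorm; simpc => /=.
rewrite -subr_ge0.
have -> : r ^+ 2 / c * (t1 ^+ 2 + t2 ^+ 2) -
  (2 * r * (y1 * t1 + y2 * t2) - (y1 ^+ 2 + y2 ^+ 2) * c) =
  ((r * t1 - c * y1) ^+ 2 + (r * t2 - c * y2) ^+ 2) / c.
  by field; rewrite gt_eqF.
by apply: divr_ge0; [rewrite addr_ge0 ?sqr_ge0 | exact: ltW].
Qed.

(** * Adjoints, positivity and spectral decomposition *)

Lemma adjmxE m n (X : 'M[C]_(m, n)) i j : adjmx X i j = Num.conj (X j i).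
Proof. by rewrite !mxE. Qed.

Lemma adjmxM m n p (X : 'M[C]_(m, n)) (Y : 'M[C]_(n, p)) :
  adjmx (X *m Y) = adjmx Y *m adjmx X.
Proof. by rewrite /adjmx map_mxM trmx_mul. Qed.

Lemma adjmxK m n (X : 'M[C]_(m, n)) : adjmx (adjmx X) = X.
Proof. by apply/matrixP => i j; rewrite !adjmxE conjCK. Qed.

Lemma psd_adj n (D : 'M[C]_n) : psd D -> adjmx D = D.
Proof.
case=> /is_hermitianmxP; rewrite expr0 scale1r => e _.
by rewrite [RHS]e /adjmx map_trmx.
Qed.

Lemma psd_conj_ge0 n (D : 'M[C]_n) (V : 'M[C]_n) k : psd D ->
  0 <= (V *m D *m adjmx V) k k.
Proof.
case=> _ /(_ (row k V)); congr (0 <= _).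
rewrite -row_mul [LHS]mxE [RHS]mxE; apply: eq_bigr => j _.
by rewrite !adjmxE !mxE.
Qed.

(** Taking the real part loses nothing on positive matrices, whose spectral diagonal is real. *)
Definition eigval n (D : 'M[C]_n) (j : 'I_n) : R := Re (spectral_diag D 0 j).

Lemma spectralmx_adjK n (D : 'M[C]_n) : spectralmx D *m adjmx (spectralmx D) = 1%:M.
Proof.
have /unitarymxP := spectral_unitarymx D.
by rewrite /adjmx -map_trmx.
Qed.

Lemma adj_spectralmxK n (D : 'M[C]_n) : adjmx (spectralmx D) *m spectralmx D = 1%:M.
Proof. exact/mulmx1C/spectralmx_adjK. Qed.

Lemma invmx_spectralmx n (D : 'M[C]_n) : invmx (spectralmx D) = adjmx (spectralmx D).
Proof. by rewrite invmx_unitary ?spectral_unitarymx // -map_trmx. Qed.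

Lemma spectral_diag_ge0 n (D : 'M[C]_n) j : psd D -> 0 <= spectral_diag D 0 j.
Proof.
move=> pD; have /orthomx_spectralP eD := hermitian_normalmx (proj1 pD).
have := @psd_conj_ge0 _ D (spectralmx D) j pD.
rewrite {2}eD invmx_spectralmx.
rewrite -!mulmxA spectralmx_adjK mulmx1 !mulmxA spectralmx_adjK mul1mx.
by rewrite mxE eqxx mulr1n.
Qed.

Lemma eigval_ge0 n (D : 'M[C]_n) j : psd D -> 0 <= eigval D j.
Proof. by move=> pD; rewrite Re_ge0 ?spectral_diag_ge0. Qed.

Lemma psd_spectralE n (D : 'M[C]_n) : psd D ->
  D = adjmx (spectralmx D) *m diag_mx (\row_j toC (eigval D j)) *m spectralmx D.
Proof.
move=> pD; have /orthomx_spectralP eD := hermitian_normalmx (proj1 pD).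
rewrite [LHS]eD invmx_spectralmx; congr (_ *m diag_mx _ *m _).
by apply/rowP => j; rewrite mxE toC_Re_ge0 ?spectral_diag_ge0.
Qed.

(** * Traces against positive matrices *)

Lemma Re_tr_mulZ n (D X : 'M[C]_n) (r : R) :
  Re (\tr (D *m (toC r *: X))) = r * Re (\tr (D *m X)).
Proof. by rewrite -scalemxAr mxtraceZ Re_toCM. Qed.

Lemma Re_tr_mulD n (D X Y : 'M[C]_n) :
  Re (\tr (D *m (X + Y))) = Re (\tr (D *m X)) + Re (\tr (D *m Y)).
Proof. by rewrite mulmxDr mxtraceD ReD. Qed.

Lemma Re_tr_mul1 n (D : 'M[C]_n) : density D -> Re (\tr (D *m 1%:M)) = 1.
Proof. by case=> _ tD; rewrite mulmx1 tD. Qed.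

Lemma Re_tr_mulB1 n (D b : 'M[C]_n) : density D ->
  Re (\tr (D *m (1%:M - b))) = 1 - Re (\tr (D *m b)).
Proof. by move=> dD; rewrite mulmxBr raddfB /= ReD ReN Re_tr_mul1. Qed.

Lemma Re_tr_diag_mul n (U X : 'M[C]_n) (r : 'I_n -> R) :
  Re (\tr (adjmx U *m diag_mx (\row_j toC (r j)) *m U *m X)) =
  \sum_j r j * Re ((U *m X *m adjmx U) j j).
Proof.
rewrite -!mulmxA mxtrace_mulC -!mulmxA /mxtrace Re_sum.
by apply: eq_bigr => j _; rewrite mul_diag_mx !mxE Re_toCM.
Qed.

(** In an eigenbasis of [D] the trace is a sum of eigenvalues times diagonal entries of the
    conjugated [E], all nonnegative. *)
Lemma Re_tr_psd_ge0 n (D E : 'M[C]_n) : psd D -> psd E ->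
  0 <= Re (\tr (D *m E)).
Proof.
move=> pD pE; rewrite (psd_spectralE pD) Re_tr_diag_mul.
by apply: sumr_ge0 => j _; rewrite mulr_ge0 ?eigval_ge0 // Re_ge0 // psd_conj_ge0.
Qed.

Lemma psd_conj n m (B : 'M[C]_(m, n)) (E : 'M[C]_n) : psd E ->
  psd (B *m E *m adjmx B).
Proof.
move=> pE; have hE := psd_adj pE; have [_ qE] := pE; split.
  apply/is_hermitianmxP; rewrite expr0 scale1r -map_trmx.
  by rewrite -/(adjmx _) !adjmxM adjmxK hE mulmxA.
by move=> v; have := qE (v *m B); rewrite adjmxM !mulmxA.
Qed.

(* [b - b b = b (1 - b) b + (1 - b) b (1 - b)] *)
Lemma Re_tr_effect_sqr n (D b : 'M[C]_n) :
  psd D -> psd b -> psd (1%:M - b) ->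
  Re (\tr (D *m (b *m b))) <= Re (\tr (D *m b)).
Proof.
move=> pD pb pb'.
have := Re_tr_psd_ge0 pD (psd_conj b pb').
have := Re_tr_psd_ge0 pD (psd_conj (1%:M - b) pb).
rewrite !psd_adj // => h1 h2; rewrite -subr_ge0.
have := addr_ge0 h1 h2; rewrite -Re_tr_mulD.
have -> : (1%:M - b) *m b *m (1%:M - b) + b *m (1%:M - b) *m b = b - b *m b.
  rewrite !(mulmxBl, mulmxBr, mulmx1, mul1mx).
  by rewrite subrK.
by rewrite mulmxBr raddfB /= ReD ReN.
Qed.

(* The two relative-entropy spectra [r], [s] are coupled through the overlaps
   [T = U V^*]; testing with [Y = U X V^*] turns the left-hand side into a sum
   of quadratic polynomials in the entries of [Y]. *)
Lemma quadratic_test_le n (D E U V X : 'M[C]_n) (r s : 'I_n -> R) (l : R) :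
  U *m adjmx U = 1%:M -> adjmx U *m U = 1%:M ->
  V *m adjmx V = 1%:M -> adjmx V *m V = 1%:M ->
  (forall j, 0 <= r j) -> (forall j, 0 <= s j) -> adjmx X = X -> 0 < l ->
  D = adjmx U *m diag_mx (\row_j toC (r j)) *m U ->
  E = adjmx V *m diag_mx (\row_j toC (s j)) *m V ->
  2 * Re (\tr (D *m X)) - Re (\tr (E *m (X *m X))) - l * Re (\tr (D *m (X *m X)))
  <= \sum_j \sum_k r j ^+ 2 / (s k + l * r j) * sqnorm ((U *m adjmx V) j k).
Proof.
move=> UU UU' VV VV' r0 s0 hX l0 -> ->.
pose T := U *m adjmx V; pose Y := U *m X *m adjmx V.
(* Inserting [adjmx V *m V = 1] between the factors expresses everything through the entries of [Y]
   and [T]. *)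
have eDX j : Re ((U *m X *m adjmx U) j j) = \sum_k Re (Y j k * Num.conj (T j k)).
  have -> : U *m X *m adjmx U = Y *m adjmx T.
    by rewrite /Y /T adjmxM adjmxK !mulmxA -[_ *m _ *m V]mulmxA VV' mulmx1.
  by rewrite mxE Re_sum; apply: eq_bigr => k _; rewrite adjmxE.
have eDXX j : Re ((U *m (X *m X) *m adjmx U) j j) = \sum_k sqnorm (Y j k).
  have -> : U *m (X *m X) *m adjmx U = Y *m adjmx Y.
    by rewrite /Y !adjmxM adjmxK hX !mulmxA -[_ *m _ *m V]mulmxA VV' mulmx1.
  by rewrite mxE Re_sum; apply: eq_bigr => k _; rewrite adjmxE mul_conj_sqnorm.
have eEXX k : Re ((V *m (X *m X) *m adjmx V) k k) = \sum_j sqnorm (Y j k).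
  have -> : V *m (X *m X) *m adjmx V = adjmx Y *m Y.
    by rewrite /Y !adjmxM adjmxK hX !mulmxA -[_ *m _ *m U]mulmxA UU' mulmx1.
  rewrite mxE Re_sum; apply: eq_bigr => j _.
  by rewrite adjmxE mulrC mul_conj_sqnorm.
rewrite !Re_tr_diag_mul.
under eq_bigr do rewrite eDX mulr_sumr.
under [X in _ - X - _ <= _]eq_bigr do rewrite eEXX mulr_sumr.
under [X in _ - l * X <= _]eq_bigr do rewrite eDXX mulr_sumr.
rewrite [X in _ - X - _ <= _]exchange_big/= !mulr_sumr -!sumrB.
apply: ler_sum => j _; rewrite !mulr_sumr -!sumrB; apply: ler_sum => k _.
(* Completing the square needs [s k + l * r j] positive, which [r j > 0] ensures. If [r j = 0], the
   right side is 0 and the left side is [- s k] times a square. *)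
have [r_gt0|] := ltP 0 (r j).
  have c0 : 0 < s k + l * r j by rewrite ltr_wpDl // mulr_gt0.
  apply: le_trans (completed_square (Y j k) (T j k) (r j) c0).
  by rewrite le_eqVlt; apply/orP; left; apply/eqP; ring.
move=> rle0; have -> : r j = 0 by apply/le_anti/andP.
rewrite expr0n/= !mul0r !mulr0 sub0r subr0 oppr_le0.
by rewrite mulr_ge0 ?sqnorm_ge0.
Qed.

(** * Eigenvalues, overlaps of eigenbases, and mixtures *)

Lemma sum_eigval n (D : 'M[C]_n) : density D -> \sum_j eigval D j = 1.
Proof.
move=> dD; have pD := proj1 dD; have := Re_tr_mul1 dD.
rewrite {1}(psd_spectralE pD) Re_tr_diag_mul => <-.
by apply: eq_bigr => j _; rewrite mulmx1 spectralmx_adjK mxE eqxx mulr1.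
Qed.

Lemma sum_sqnorm_row n (T : 'M[C]_n) j : T *m adjmx T = 1%:M ->
  \sum_k sqnorm (T j k) = 1.
Proof.
move=> /matrixP/(_ j j); rewrite !mxE eqxx mulr1n => h.
rewrite -[RHS]/(complex.Re (1 : C)) -h.
by rewrite Re_sum; apply: eq_bigr => k _; rewrite adjmxE mul_conj_sqnorm.
Qed.

(** Entry [j k] is the inner product of row [j] of the eigenbasis of [D] with row [k] of that of
    [E]; its squared modulus is a transition probability. *)
Definition overlap n (D E : 'M[C]_n) : 'M[C]_n :=
  spectralmx D *m adjmx (spectralmx E).

Lemma overlap_adjK n (D E : 'M[C]_n) : overlap D E *m adjmx (overlap D E) = 1%:M.
Proof.
rewrite /overlap adjmxM adjmxK mulmxA -[_ *m _ *m spectralmx E]mulmxA.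
by rewrite adj_spectralmxK mulmx1 spectralmx_adjK.
Qed.

(** Measuring [D] in the eigenbasis of [E] mixes the spectrum of [D] with the transition
    probabilities. *)
Lemma eigvalE n (D E : 'M[C]_n) k : psd D ->
  Re ((spectralmx E *m D *m adjmx (spectralmx E)) k k) =
  \sum_j eigval D j * sqnorm (overlap D E j k).
Proof.
move=> pD; rewrite {1}(psd_spectralE pD).
set U := spectralmx D; set V := spectralmx E.
have -> : V *m (adjmx U *m diag_mx (\row_j toC (eigval D j)) *m U) *m adjmx V =
  adjmx (overlap D E) *m (diag_mx (\row_j toC (eigval D j)) *m overlap D E).
  by rewrite /overlap adjmxM adjmxK !mulmxA.
rewrite mxE Re_sum; apply: eq_bigr => j _.
rewrite adjmxE mul_diag_mx !mxE mulrCA Re_toCM.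
by rewrite [Num.conj _ * _]mulrC mul_conj_sqnorm.
Qed.

Lemma eigval_self n (D : 'M[C]_n) k : psd D ->
  Re ((spectralmx D *m D *m adjmx (spectralmx D)) k k) = eigval D k.
Proof.
move=> pD; rewrite eigvalE // (bigD1 k) //= /overlap spectralmx_adjK big1 => [|j jk].
  by rewrite mxE eqxx addr0 /sqnorm /= expr0n/= addr0 expr1n mulr1.
by rewrite mxE (negPf jk) /sqnorm /= expr0n/= addr0 mulr0.
Qed.

Lemma psd0 n : psd (0 : 'M[C]_n).
Proof.
split=> [|v]; last by rewrite mulmx0 mul0mx mxE.
by apply/is_hermitianmxP; rewrite trmx0 map_mx0 scaler0.
Qed.

Lemma psdD n (D E : 'M[C]_n) : psd D -> psd E -> psd (D + E).
Proof.
move=> pD pE; split=> [|v].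
  apply/is_hermitianmxP; rewrite expr0 scale1r -map_trmx -/(adjmx _).
  by rewrite /adjmx map_mxD raddfD /= -!/(adjmx _) !psd_adj.
by rewrite mulmxDr mulmxDl mxE addr_ge0 //; [have [_] := pD | have [_] := pE].
Qed.

Lemma psdZ n (r : R) (D : 'M[C]_n) : 0 <= r -> psd D -> psd (toC r *: D).
Proof.
move=> r0 pD; split=> [|v].
  apply/is_hermitianmxP; rewrite expr0 scale1r -map_trmx -/(adjmx _).
  by apply/matrixP => i j; rewrite adjmxE !mxE rmorphM /= conj_toC -adjmxE psd_adj.
by rewrite -scalemxAr -scalemxAl mxE mulr_ge0 ?toC_ge0 //; have [_] := pD.
Qed.

Lemma psd_sum (I : finType) n (P : pred I) (D : I -> 'M[C]_n) :
  (forall i, P i -> psd (D i)) -> psd (\sum_(i | P i) D i).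
Proof. by move=> pD; elim/big_ind: _ => //; [exact: psd0 | exact: psdD]. Qed.

Lemma psd_mix (I : finType) n (w : I -> R) (D : I -> 'M[C]_n) :
  (forall i, 0 <= w i) -> (forall i, psd (D i)) -> psd (\sum_i toC (w i) *: D i).
Proof. by move=> w0 pD; apply: psd_sum => i _; apply: psdZ. Qed.

Lemma density_mix (I : finType) n (w : I -> R) (D : I -> 'M[C]_n) :
  distribution w -> (forall i, density (D i)) -> density (\sum_i toC (w i) *: D i).
Proof.
move=> [w0 w1] dD; split; first by apply: psd_mix => // i; case: (dD i).
rewrite raddf_sum /=.
under eq_bigr do rewrite mxtraceZ (proj2 (dD _)) mulr1.
by rewrite -(rmorph_sum (real_complex R)) w1.
Qed.

(** Diagonal entries in the eigenbasis of [E] are linear in the matrix. Hence the classical law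
    built from the spectra of the [D i] and the overlaps has the spectrum of [E] as its
    [k]-marginal. *)
Lemma eigval_mix (I : finType) n (w : I -> R) (D : I -> 'M[C]_n) k :
  (forall i, 0 <= w i) -> (forall i, psd (D i)) ->
  let E := \sum_i toC (w i) *: D i in
  eigval E k = \sum_i w i * \sum_j eigval (D i) j * sqnorm (overlap (D i) E j k).
Proof.
move=> w0 pD E; rewrite -eigval_self; last exact: psd_mix.
rewrite {2}/E mulmx_sumr mulmx_suml summxE Re_sum; apply: eq_bigr => i _.
by rewrite -scalemxAr -scalemxAl mxE Re_toCM eigvalE.
Qed.

(** The square of [X] is a polynomial in [b] whose [b^2] coefficient [(x1 - x0)^2] is nonnegative,
    so replacing [b^2] by [b] only increases the trace. *)
Lemma effect_test n (D b : 'M[C]_n) (x0 x1 : R) :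
  density D -> psd b -> psd (1%:M - b) ->
  let X := toC x0 *: 1%:M + toC (x1 - x0) *: b in
  let p := Re (\tr (D *m b)) in
  [/\ adjmx X = X, Re (\tr (D *m X)) = x1 * p + x0 * (1 - p)
    & Re (\tr (D *m (X *m X))) <= x1 ^+ 2 * p + x0 ^+ 2 * (1 - p)].
Proof.
move=> dD pb pb' X p; have pD := proj1 dD; split.
- apply/matrixP => i j; rewrite adjmxE !mxE rmorphD !rmorphM /= !conj_toC.
  by rewrite -[Num.conj (b _ _)]adjmxE psd_adj // rmorphMn rmorph1 eq_sym.
- rewrite Re_tr_mulD !Re_tr_mulZ Re_tr_mul1 // -/p; ring.
- have -> : X *m X = toC (x0 ^+ 2) *: 1%:M + toC (2 * x0 * (x1 - x0)) *: b
      + toC ((x1 - x0) ^+ 2) *: (b *m b).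
    rewrite /X mulmxDl !mulmxDr -!scalemxAl -!scalemxAr !mul1mx mulmx1 !scalerA.
    rewrite -!toCM -addrA [in RHS]expr2 -[in RHS]addrA; congr (_ + _).
    rewrite addrA -scalerDl -toCD -expr2; congr (toC _ *: _ + _); ring.
  have := ler_wpM2l (sqr_ge0 (x1 - x0)) (Re_tr_effect_sqr pD pb pb').
  set t := Re (\tr (D *m (b *m b))); rewrite -/p.
  have lin3 (r1 r2 r3 : R) (Y Z : 'M[C]_n) :
      Re (\tr (D *m (toC r1 *: 1%:M + toC r2 *: Y + toC r3 *: Z))) =
      r1 + r2 * Re (\tr (D *m Y)) + r3 * Re (\tr (D *m Z)).
    by rewrite 2!Re_tr_mulD 3!Re_tr_mulZ Re_tr_mul1 // mulr1.
  rewrite lin3 -/p -/t.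
  lra.
Qed.

End Complex.

(** * Entropy bounds and the Fano-type estimate *)

Section Entropy.
Variable R : realType.
Local Notation C := R[i].
Local Notation Re := complex.Re.

Lemma ln2_gt0 : 0 < ln (2 : R).
Proof. by rewrite ln_gt0 // ltr1n. Qed.

(** This is [ln y <= y - 1] at [y = c / t]; summed over two distributions it gives the Gibbs
    inequality. *)
Lemma gibbs_le (t c : R) : 0 <= t -> 0 < c -> t * (ln c - ln t) <= c - t.
Proof.
rewrite le_eqVlt => /predU1P[<- c0|t0 c0]; first by rewrite mul0r subr0 ltW.
rewrite -ln_div ?posrE //.
have e : c / t = 1 + (c / t - 1) by ring.
have h : ln (c / t) <= c / t - 1.
  by rewrite {1}e le_ln1Dx // ltrBrDl subrr divr_gt0.
apply: le_trans (ler_wpM2l (ltW t0) h) _.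
by rewrite le_eqVlt; apply/orP; left; apply/eqP; field; rewrite gt_eqF.
Qed.

Lemma etaE (t : R) : Defs.eta t = t * ln t / ln 2.
Proof.
by rewrite /Defs.eta /log2; have [->|_] := eqVneq t 0; rewrite ?mul0r ?mul0r // mulrA.
Qed.

Lemma vN_entropyE n (D : 'M[C]_n) :
  vN_entropy D = - (\sum_j eigval D j * ln (eigval D j)) / ln 2.
Proof.
rewrite /vN_entropy mulNr mulr_suml; congr (- _).
by apply: eq_bigr => j _; rewrite etaE.
Qed.

Lemma vN_entropy_ge0 n (D : 'M[C]_n) : density D -> 0 <= vN_entropy D.
Proof.
move=> dD; have pD := proj1 dD.
rewrite vN_entropyE divr_ge0 ?(ltW ln2_gt0) // -sumrN sumr_ge0 // => j _.
rewrite -mulrN mulr_ge0 ?eigval_ge0 // oppr_ge0 ln_le0 //.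
rewrite -(sum_eigval dD) (bigD1 j) //= lerDl sumr_ge0 // => k _.
exact: eigval_ge0.
Qed.

(** Gibbs inequality for the spectrum of [D] against the uniform distribution. *)
Lemma vN_entropy_le n (D : 'M[C]_n) : density D -> vN_entropy D <= log2 n%:R.
Proof.
move=> dD; have pD := proj1 dD.
have n0 : (0 < n)%N.
  case: n D dD {pD} => [|//] D /sum_eigval; rewrite big_ord0 => /esym/eqP.
  by rewrite oner_eq0.
rewrite vN_entropyE /log2 ler_pM2r ?invr_gt0 ?ln2_gt0 //.
have nR : 0 < n%:R :> R by rewrite ltr0n.
have : \sum_j eigval D j * (ln n%:R^-1 - ln (eigval D j)) <=
    \sum_(j < n) (n%:R^-1 - eigval D j).
  by apply: ler_sum => j _; rewrite gibbs_le ?eigval_ge0 ?invr_gt0.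
rewrite sumrB sumr_const card_ord -(mulr_natr n%:R^-1) mulVf ?gt_eqF //.
rewrite sum_eigval // subrr.
under eq_bigr do rewrite mulrBr; rewrite sumrB -mulr_suml sum_eigval // mul1r.
rewrite lnV ?posrE //; lra.
Qed.

(** Gibbs inequality against [(1/2, 1/2)]; this is the source of the [1] lost in Fano's estimate. *)
Lemma binary_entropy_le (P : R) : 0 <= P <= 1 ->
  - (P * ln P) - (1 - P) * ln (1 - P) <= ln 2.
Proof.
move=> /andP[P0 P1].
have h0 : 0 < 2^-1 :> R by rewrite invr_gt0.
have h1 := gibbs_le P0 h0.
have h2 : (1 - P) * (ln 2^-1 - ln (1 - P)) <= 2^-1 - (1 - P).
  by rewrite gibbs_le ?subr_ge0.
move: h1 h2; rewrite lnV ?posrE //; lra.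
Qed.

(** Data processing to a binary event: hit and miss have weights [(P, 1 - P)] under the true states,
    and at most [(Q, 1)] when each [D i] is replaced by the average [E]. *)
Lemma holevo_fano (I : finType) n (w : I -> R) (D b : I -> 'M[C]_n) (Q : R) :
  distribution w -> (forall i, density (D i)) ->
  (forall i, psd (b i)) -> (forall i, psd (1%:M - b i)) ->
  let E := \sum_i toC (w i) *: D i in
  0 < Q -> \sum_i w i * Re (\tr (E *m b i)) <= Q ->
  - (\sum_i w i * Re (\tr (D i *m b i))) * log2 Q - 1 <=
  vN_entropy E - \sum_i w i * vN_entropy (D i).
Proof.
move=> [w0 w1] dD pb pb' E Q0 hQ.
have pD i := proj1 (dD i).
have dE : density E by apply: density_mix.
have pE := proj1 dE.
set P := \sum_i _.
have p0 i : 0 <= Re (\tr (D i *m b i)) by apply: Re_tr_psd_ge0.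
have p1 i : Re (\tr (D i *m b i)) <= 1.
  have := Re_tr_psd_ge0 (pD i) (pb' i).
  by rewrite Re_tr_mulB1 // subr_ge0.
have P0 : 0 <= P by apply: sumr_ge0 => i _; rewrite mulr_ge0.
have P1 : P <= 1 by rewrite -w1; apply: ler_sum => i _; rewrite ler_piMr.
pose T i := overlap (D i) E; pose r i := eigval (D i); pose s := eigval E.
have r0 i j : 0 <= r i j by apply: eigval_ge0.
have s0 j : 0 <= s j by apply: eigval_ge0.
have sE k : s k = \sum_i w i * \sum_j r i j * sqnorm (T i j k) by apply: eigval_mix.
pose p (z : I * ('I_n * 'I_n)) : R :=
  w z.1 * (r z.1 z.2.1 * sqnorm (T z.1 z.2.1 z.2.2)).
(* Ratio of the second Nussbaum-Szkola weight to [p z]; the default 1 keeps it positive where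
   [p z = 0], and such terms carry weight 0. *)
pose a (z : I * ('I_n * 'I_n)) : R :=
  if p z == 0 then 1 else s z.2.2 / r z.1 z.2.1.
have sum3 (F : I -> 'I_n -> 'I_n -> R) :
    \sum_z F z.1 z.2.1 z.2.2 = \sum_i \sum_j \sum_k F i j k.
  rewrite -(pair_bigA _ (fun i jk => F i jk.1 jk.2)) /=.
  by apply: eq_bigr => i _; rewrite pair_bigA.
have pge0 z : 0 <= p z by rewrite !mulr_ge0 // sqnorm_ge0.
(* The marginal identity [sE] makes [s k] at least [p z], so [s] cannot vanish on the support of
   [p]. *)
have pos z : p z != 0 -> 0 < r z.1 z.2.1 /\ 0 < s z.2.2.
  move=> pz; have rz : r z.1 z.2.1 != 0.
    by apply: contra_neq pz => h; rewrite /p h mul0r mulr0.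
  split; first by rewrite lt_def rz r0.
  apply: (@lt_le_trans _ _ (p z)); first by rewrite lt_def pz pge0.
  rewrite sE (bigD1 z.1) //= (bigD1 z.2.1) //= mulrDr -addrA lerDl addr_ge0 //.
    by rewrite mulr_ge0 // sumr_ge0 // => j _; rewrite mulr_ge0 ?sqnorm_ge0.
  apply: sumr_ge0 => i _; rewrite mulr_ge0 // sumr_ge0 // => j _.
  by rewrite mulr_ge0 ?sqnorm_ge0.
have agt0 z : 0 < a z.
  by rewrite /a; case: ifPn => // /pos[? ?]; rewrite divr_gt0.
have row1 i j : \sum_k sqnorm (T i j k) = 1.
  by apply: sum_sqnorm_row; apply: overlap_adjK.
have sump : \sum_z p z = 1.
  rewrite /p (sum3 (fun i j k => w i * (r i j * sqnorm (T i j k)))) -w1.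
  apply: eq_bigr => i _; under eq_bigr do rewrite -mulr_sumr -mulr_sumr row1 mulr1.
  by rewrite -mulr_sumr sum_eigval // mulr1.
pose q (h : bool) := if h then P else 1 - P.
(* The corresponding ratio of [(Q, 1)] to [(P, 1 - P)], again with default 1 where the weight
   vanishes. *)
pose c (h : bool) := if h then (if P == 0 then 1 else Q / P)
                    else (if 1 - P == 0 then 1 else (1 - P)^-1).
have q0 h : 0 <= q h by case: h; rewrite /q // subr_ge0.
have cgt0 h : 0 < c h.
  have aux x y : 0 <= x -> 0 < y -> 0 < (if x == 0 then 1 else y / x) :> R.
    by move=> x0 y0; case: eqP => // /eqP nx; rewrite divr_gt0 // lt_def nx.
  case: h; rewrite /c; first exact: aux.
  by rewrite -[_^-1]mul1r; apply: aux; rewrite ?subr_ge0.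
have sumq : \sum_h q h = 1 by rewrite big_bool /q /= addrCA subrr addr0.
have stieltjes (l : R) : 0 < l -> \sum_h q h / (c h + l) <= \sum_z p z / (a z + l).
  move=> l0.
  have pE3 z : p z / (a z + l) = w z.1 * (r z.1 z.2.1 ^+ 2 /
      (s z.2.2 + l * r z.1 z.2.1) * sqnorm (T z.1 z.2.1 z.2.2)).
    have [pz|pz] := eqVneq (p z) 0.
      rewrite pz mul0r; move/eqP: pz; rewrite /p !mulf_eq0.
      by case/or3P => /eqP->; rewrite ?expr0n/= ?mul0r ?mulr0.
    have [rz sz] := pos z pz; rewrite /a (negPf pz) /p; field.
    by rewrite !gt_eqF // ?addr_gt0 ?mulr_gt0.
  under [leRHS]eq_bigr do rewrite pE3.
  rewrite (sum3 (fun i j k =>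
    w i * (r i j ^+ 2 / (s k + l * r i j) * sqnorm (T i j k)))).
  have [u0 u1] : 0 < Q + l * P /\ 0 < 1 + l * (1 - P).
    by split; rewrite ltr_pwDl // mulr_ge0 ?subr_ge0 ?(ltW l0).
  (* Maximisers of [2 x P - x^2 (Q + l P)] and [2 x (1 - P) - x^2 (1 + l (1 - P))]; the maxima are
     [P x1] and [(1 - P) x0]. *)
  pose x1 := P / (Q + l * P); pose x0 := (1 - P) / (1 + l * (1 - P)).
  have -> : \sum_h q h / (c h + l) = P * x1 + (1 - P) * x0.
    rewrite big_bool /q /c /x1 /x0; congr (_ + _).
      case: eqP => [->|/eqP nP]; first by rewrite !mul0r.
      by field; rewrite nP !gt_eqF // addrC.
    case: eqP => [->|/eqP nP]; first by rewrite !mul0r.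
    by field; rewrite nP !gt_eqF // addrC.
  pose X i := toC x0 *: 1%:M + toC (x1 - x0) *: b i.
  apply: (@le_trans _ _ (\sum_i w i * (2 * Re (\tr (D i *m X i))
      - Re (\tr (E *m (X i *m X i)))
      - l * Re (\tr (D i *m (X i *m X i)))))); last first.
    apply: ler_sum => i _; under eq_bigr do rewrite -mulr_sumr.
    rewrite -mulr_sumr ler_wpM2l //.
    have [hX _ _] := effect_test x0 x1 (dD i) (pb i) (pb' i).
    apply: quadratic_test_le; rewrite ?spectralmx_adjK ?adj_spectralmxK //;
      exact: psd_spectralE.
  have h1 : \sum_i w i * Re (\tr (D i *m X i)) = x1 * P + x0 * (1 - P).
    transitivity (\sum_i (x1 * (w i * Re (\tr (D i *m b i)))
        + x0 * (w i - w i * Re (\tr (D i *m b i))))).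
      apply: eq_bigr => i _.
      have [_ -> _] := effect_test x0 x1 (dD i) (pb i) (pb' i); ring.
    by rewrite big_split /= -!mulr_sumr sumrB w1.
  have h2 : \sum_i w i * Re (\tr (D i *m (X i *m X i))) <=
      x1 ^+ 2 * P + x0 ^+ 2 * (1 - P).
    apply: (@le_trans _ _ (\sum_i (x1 ^+ 2 * (w i * Re (\tr (D i *m b i)))
        + x0 ^+ 2 * (w i - w i * Re (\tr (D i *m b i)))))).
      apply: ler_sum => i _.
      have [_ _ /(ler_wpM2l (w0 i)) h] := effect_test x0 x1 (dD i) (pb i) (pb' i).
      apply: le_trans h _; rewrite le_eqVlt; apply/orP; left; apply/eqP; ring.
    by rewrite big_split /= -!mulr_sumr sumrB w1.
  (* The exact weights [Q'] and [1 - Q'] are relaxed to [Q] and 1. *)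
  have h3 : \sum_i w i * Re (\tr (E *m (X i *m X i))) <= x1 ^+ 2 * Q + x0 ^+ 2.
    pose Q' := \sum_i w i * Re (\tr (E *m b i)).
    have Q'0 : 0 <= Q' by apply: sumr_ge0 => i _; rewrite mulr_ge0 // Re_tr_psd_ge0.
    apply: (@le_trans _ _ (x1 ^+ 2 * Q' + x0 ^+ 2 * (1 - Q'))).
      apply: (@le_trans _ _ (\sum_i (x1 ^+ 2 * (w i * Re (\tr (E *m b i)))
          + x0 ^+ 2 * (w i - w i * Re (\tr (E *m b i)))))).
        apply: ler_sum => i _.
        have [_ _ /(ler_wpM2l (w0 i)) h] := effect_test x0 x1 dE (pb i) (pb' i).
        apply: le_trans h _; rewrite le_eqVlt; apply/orP; left; apply/eqP; ring.
      by rewrite big_split /= -!mulr_sumr sumrB w1.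
    apply: lerD; first by rewrite ler_wpM2l ?sqr_ge0.
    by rewrite ler_piMr ?sqr_ge0 // gerBl.
  have -> : \sum_i w i * (2 * Re (\tr (D i *m X i))
      - Re (\tr (E *m (X i *m X i))) - l * Re (\tr (D i *m (X i *m X i)))) =
      2 * (\sum_i w i * Re (\tr (D i *m X i)))
      - (\sum_i w i * Re (\tr (E *m (X i *m X i))))
      - l * (\sum_i w i * Re (\tr (D i *m (X i *m X i)))).
    rewrite !mulr_sumr -!sumrB; apply: eq_bigr => i _; ring.
  rewrite h1.
  (* By optimality of [x1] and [x0] the quadratic terms cancel half of the linear ones. *)
  have e1 : x1 * (Q + l * P) = P by rewrite /x1 divfK // gt_eqF.
  have e0 : x0 * (1 + l * (1 - P)) = 1 - P by rewrite /x0 divfK // gt_eqF.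
  have := ler_wpM2l (ltW l0) h2.
  have -> : l * (x1 ^+ 2 * P + x0 ^+ 2 * (1 - P)) =
     x1 * (x1 * (Q + l * P)) - x1 ^+ 2 * Q
     + x0 * (x0 * (1 + l * (1 - P))) - x0 ^+ 2 by ring.
  rewrite e1 e0; lra.
have := stieltjes_le_ln pge0 agt0 q0 cgt0 (etrans sump (esym sumq)) stieltjes.
(* The logarithm of the ratio splits, and summing out the remaining indices gives [- ln 2] times the
   Holevo quantity. *)
have -> : \sum_z p z * ln (a z) =
    (\sum_k s k * ln (s k)) - \sum_i w i * \sum_j r i j * ln (r i j).
  transitivity (\sum_z (p z * ln (s z.2.2) - p z * ln (r z.1 z.2.1))).
    apply: eq_bigr => z _.
    have [->|pz] := eqVneq (p z) 0; first by rewrite !mul0r subr0.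
    by have [rz sz] := pos z pz; rewrite /a (negPf pz) -mulrBr ln_div.
  rewrite sumrB; congr (_ - _).
    rewrite (sum3 (fun i j k => w i * (r i j * sqnorm (T i j k)) * ln (s k))).
    under [RHS]eq_bigr do rewrite {1}sE mulr_suml.
    rewrite [RHS]exchange_big /=; apply: eq_bigr => i _.
    rewrite [LHS]exchange_big /=; apply: eq_bigr => k _.
    by rewrite mulr_sumr mulr_suml.
  rewrite (sum3 (fun i j k => w i * (r i j * sqnorm (T i j k)) * ln (r i j))).
  apply: eq_bigr => i _; rewrite mulr_sumr; apply: eq_bigr => j _.
  by rewrite -mulr_suml -!mulr_sumr row1 mulr1 mulrA.
have -> : \sum_h q h * ln (c h) =
    P * ln Q - P * ln P - (1 - P) * ln (1 - P).
  rewrite big_bool /q /c.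
  have -> : P * ln (if P == 0 then 1 else Q / P) = P * ln Q - P * ln P.
    case: eqP => [->|/eqP nP]; first by rewrite !mul0r subr0.
    by rewrite ln_div ?posrE // ?mulrBr // lt_def nP.
  congr (_ + _); case: eqP => [->|/eqP nP]; first by rewrite !mul0r oppr0.
  by rewrite lnV ?posrE ?mulrN // lt_def nP subr_ge0.
have := @binary_entropy_le P; rewrite P0 P1 => /(_ isT) hb hs.
have -> : \sum_i w i * vN_entropy (D i) =
    - (\sum_i w i * \sum_j r i j * ln (r i j)) / ln 2.
  rewrite -sumrN mulr_suml; apply: eq_bigr => i _.
  by rewrite vN_entropyE !mulNr mulrN mulrA.
rewrite vN_entropyE -/s /log2 -(ler_pM2r ln2_gt0) !mulrBl !mulrA.
rewrite !divfK ?gt_eqF ?ln2_gt0 //; lra.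
Qed.

End Entropy.

(** * Capacity bounds and codes *)

Section Capacity.
Variables (R : realType) (A : finType) (d : nat) (W : channel R A d).
Local Notation Re := complex.Re.
Hypothesis hW : cq_channel W.
Variable a : A.

(** The letter [a] excludes the default value 0 of [Dn]. *)
Lemma DnE m (v : m.-tuple A) : exists a0 : A, Dn W v = W (ext_word a0 v) 1 m.
Proof.
by rewrite /Dn; case: pickP => [a0 _|/(_ a)]; first by exists a0.
Qed.

Lemma density_Dn m (v : m.-tuple A) : density (Dn W v).
Proof.
by have [a0 ->] := DnE v; have [/(_ (ext_word a0 v))[]] := hW.
Qed.

Lemma dim_gt0 : (0 < d)%N.
Proof.
have [d0|//] := posnP d; have := sum_eigval (density_Dn [tuple a]).
rewrite big1 => [/esym/eqP|i]; first by rewrite oner_eq0.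
by exfalso; have := leq_ltn_trans (leq0n i) (ltn_ord i); rewrite expn1 d0.
Qed.

(** The entropy of the average is at most the logarithm of the dimension. Linearity in [m] bounds
    the sets behind both [Cn] and [C_Holevo], so that [sup] is a true supremum there. *)
Lemma holevo_chi_le m (p : m.-tuple A -> R) : distribution p ->
  holevo_chi W p <= m%:R * log2 d%:R.
Proof.
move=> dp; apply: (@le_trans _ _ (log2 (d ^ m)%:R)); last first.
  by rewrite /log2 natrX lnXn ?ltr0n ?dim_gt0 // -[ln _ *+ _]mulr_natl mulrA.
apply: le_trans (vN_entropy_le (density_mix dp (@density_Dn m))).
rewrite gerBl sumr_ge0 // => v _.
by rewrite mulr_ge0 ?vN_entropy_ge0 //; [case: dp | exact: density_Dn].
Qed.

Lemma holevo_chi_ub m :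
  has_ubound
    [set holevo_chi W p | p in [set p : m.-tuple A -> R | distribution p]]%classic.
Proof. by exists (m%:R * log2 d%:R) => _ [p dp <-]; exact: holevo_chi_le. Qed.

Lemma holevo_chi_le_Cn m (p : m.-tuple A -> R) : distribution p ->
  holevo_chi W p <= Cn W m.
Proof. by move=> dp; apply: (ub_le_sup (holevo_chi_ub m)); exists p. Qed.

(** Shows that the set behind [Cn] is nonempty and contains 0. *)
Lemma point_mass m (v0 : m.-tuple A) : let p v := (v == v0)%:R : R in
  distribution p /\ holevo_chi W p = 0.
Proof.
move=> p; have pE (v : m.-tuple A) : v != v0 -> p v = 0 by rewrite /p => /negPf->.
have pv0 : p v0 = 1 by rewrite /p eqxx.
split.
  split=> [v|]; first exact: ler0n.
  by rewrite (bigD1 v0) //= pv0 big1 ?addr0.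
rewrite /holevo_chi (bigD1 v0) //= big1 => [|v /pE ->]; last exact: scale0r.
rewrite [X in _ - X](bigD1 v0) //= big1 => [|v /pE ->]; last by rewrite mul0r.
by rewrite pv0 scale1r mul1r !addr0 subrr.
Qed.

Lemma Cn_ge0 m : 0 <= Cn W m.
Proof.
have [dp <-] := point_mass [tuple of nseq m a].
exact: holevo_chi_le_Cn.
Qed.

Lemma Cn_le m : Cn W m <= m%:R * log2 d%:R.
Proof.
apply: ge_sup => [|_ [p dp <-]]; last exact: holevo_chi_le.
have [dp _] := point_mass [tuple of nseq m a].
by eexists; eexists; [exact: dp | reflexivity].
Qed.

Lemma Cn_le_C_Holevo m : (0 < m)%N -> Cn W m <= m%:R * C_Holevo W.
Proof.
move=> m0; have mR : 0 < m%:R :> R by rewrite ltr0n.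
rewrite mulrC -ler_pdivrMr //; apply: ub_le_sup; last by exists m.
exists (log2 d%:R) => _ [k k0 <-].
by rewrite ler_pdivrMr ?ltr0n // mulrC Cn_le.
Qed.

Lemma C_Holevo_ge0 : 0 <= C_Holevo W.
Proof. by apply: le_trans (Cn_ge0 1) _; rewrite -[leRHS]mul1r Cn_le_C_Holevo. Qed.

(** Here [p] is the image of the uniform law on indices, so repeated codewords accumulate their
    mass. *)
Lemma holevo_chi_codebook n M (u : 'I_M -> n.-tuple A) : (0 < M)%N ->
  let p v := \sum_(i | u i == v) M%:R^-1 : R in
  distribution p /\
  holevo_chi W p = vN_entropy (\sum_i toC M%:R^-1 *: Dn W (u i)) -
    \sum_i M%:R^-1 * vN_entropy (Dn W (u i)).
Proof.
move=> M0 p; split.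
  split=> [v|]; first by rewrite sumr_ge0 // => i _; rewrite invr_ge0 ler0n.
  transitivity (\sum_(i < M) M%:R^-1 : R).
    by rewrite [RHS](partition_big u xpredT).
  rewrite sumr_const card_ord.
  by rewrite -(mulr_natr M%:R^-1) mulVf // pnatr_eq0 -lt0n.
rewrite /holevo_chi; congr (vN_entropy _ - _).
  rewrite [RHS](partition_big u xpredT) //=; apply: eq_bigr => v _.
  rewrite /p toC_sum scaler_suml.
  by apply: eq_bigr => i /eqP->.
rewrite [RHS](partition_big u xpredT) //=; apply: eq_bigr => v _.
by rewrite /p mulr_suml; apply: eq_bigr => i /eqP->.
Qed.

Lemma success_le n M (u : 'I_M -> n.-tuple A) (b : 'I_M -> 'M[R[i]]_(d ^ n)) :
  (0 < n)%N -> (0 < M)%N -> is_code b ->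
  (M%:R^-1 * \sum_i Re (\tr (Dn W (u i) *m b i))) * log2 M%:R
    <= n%:R * C_Holevo W + 1.
Proof.
move=> n0 M0 [pb pb1].
have MR : 0 < M%:R :> R by rewrite ltr0n.
have pb' i : psd (1%:M - b i).
  have -> : 1%:M - b i = (1%:M - \sum_j b j) + \sum_(j | j != i) b j.
    by rewrite (bigD1 i) //= opprD addrA subrK.
  by apply: psdD => //; apply: psd_sum.
have [dp chiE] := holevo_chi_codebook u M0.
have w1 : distribution (fun _ : 'I_M => M%:R^-1 : R).
  split=> [_|]; first by rewrite invr_ge0 ltW.
  by rewrite sumr_const card_ord -(mulr_natr M%:R^-1) mulVf ?gt_eqF.
pose E := \sum_i toC M%:R^-1 *: Dn W (u i).
have dE : density E by apply: density_mix w1 _ => i; apply: density_Dn.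
(* The [b i] sum to at most 1 and [E] has trace 1. Thus [Q = 1 / M], and [- log2 Q] becomes
   [log2 M]. *)
have hQ : \sum_i M%:R^-1 * Re (\tr (E *m b i)) <= M%:R^-1.
  rewrite -mulr_sumr ger_pMr ?invr_gt0 // -Re_sum -raddf_sum -mulmx_sumr.
  have := Re_tr_psd_ge0 (proj1 dE) pb1.
  by rewrite Re_tr_mulB1 // subr_ge0.
have MV : 0 < M%:R^-1 :> R by rewrite invr_gt0.
have := holevo_fano w1 (fun i => density_Dn (u i)) pb pb' MV hQ.
rewrite -chiE -mulr_sumr => /le_trans/(_ (holevo_chi_le_Cn dp)).
move=> /le_trans/(_ (Cn_le_C_Holevo n0)).
have -> : log2 M%:R^-1 = - log2 M%:R :> R by rewrite /log2 lnV ?posrE // mulNr.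
by rewrite mulrNN lerBlDr.
Qed.

(** Each supremum over a cylinder, bounded by 1, dominates its value at the padded codeword that
    defines [Dn]. *)
Lemma avg_error_ge n M (u : 'I_M -> n.-tuple A) (b : 'I_M -> 'M[R[i]]_(d ^ n)) :
  (0 < M)%N -> is_code b ->
  1 - M%:R^-1 * \sum_i Re (\tr (Dn W (u i) *m b i)) <= avg_error W u b.
Proof.
move=> M0 [pb _]; have MR : 0 < M%:R :> R by rewrite ltr0n.
have sum1 : M%:R^-1 * \sum_(i < M) 1 = 1 :> R.
  by rewrite sumr_const card_ord mulVf ?gt_eqF.
rewrite -[X in X - _]sum1 -mulrBr -sumrB ler_pM2l ?invr_gt0 //; apply: ler_sum => i _.
apply: ub_le_sup.
  exists 1 => _ [x _ <-]; rewrite gerBl; apply: Re_tr_psd_ge0 => //.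
  by have [/(_ x)[/(_ 1 n)[]]] := hW.
have [a0 ->] := DnE (u i); exists (ext_word a0 (u i)) => //.
by move=> j; rewrite /= (tnth_nth a0).
Qed.

End Capacity.

(** * The converse bound on the average error *)

Unset Implicit Arguments.

Theorem theorem6 (R : realType) (A : finType) (d : nat) (W : channel R A d)
  (hW : cq_channel W) (hstat : stationary W) (himc : IMC W)
  (eps : R) (heps : 0 < eps)
  (n : nat) (hn : (0 < n)%N) (M : nat)
  (u : 'I_M -> n.-tuple A) (b : 'I_M -> 'M[R[i]]_(d ^ n))
  (hcode : is_code b)
  (hM : powR 2 (n%:R * (C_Holevo W + eps)) <= M%:R) :
  1 - (C_Holevo W + n%:R^-1) / (C_Holevo W + eps) <= avg_error W u b.
Proof.
have pM : 0 < powR 2 (n%:R * (C_Holevo W + eps)) by rewrite powR_gt0.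
have M0 : (0 < M)%N by rewrite -(ltr0n R); exact: lt_le_trans hM.
(* The first letter of the first codeword witnesses that the alphabet is nonempty. *)
pose a : A := tnth (u (Ordinal M0)) (Ordinal hn).
have nR : 0 < n%:R :> R by rewrite ltr0n.
have MR : 0 < M%:R :> R by rewrite ltr0n.
have C0 := C_Holevo_ge0 hW a.
have K0 : 0 < C_Holevo W + eps by rewrite ltr_wpDl.
have logM : n%:R * (C_Holevo W + eps) <= log2 M%:R.
  by rewrite /log2 ler_pdivlMr ?ln2_gt0 // -ln_powR ler_ln ?posrE.
apply: le_trans (avg_error_ge hW a u M0 hcode).
have := success_le hW a u hn M0 hcode.
set P := _ * \sum_i _ => hP.
have P0 : 0 <= P.
  rewrite mulr_ge0 ?invr_ge0 ?ler0n // sumr_ge0 // => i _.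
  by apply: Re_tr_psd_ge0; [case: (density_Dn hW a (u i)) | case: hcode].
(* It remains to chain [P n (C + eps) <= P log2 M <= n C + 1], with [C] the Holevo capacity; the
   first inequality uses [P >= 0]. *)
rewrite lerD2l lerN2 ler_pdivlMr // -(ler_pM2l nR).
rewrite [leRHS]mulrDr mulfV ?gt_eqF // mulrCA.
exact: le_trans (ler_wpM2l P0 logM) hP.
Qed.
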